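(* Let $p$ be a prime, let $r,t,m\ge 1$ be integers, let $1\le h\le r$, and put $n:=4t(m-1)+1$. Let $H_1,\dots,H_n\le \mathbb{F}_p^r$ be subspaces, all of dimension $h$, which are $m$-generating. Let $f:\mathbb{F}_p^r\to\mathbb{C}$, and write $\widehat f=\widehat g+\epsilon$, where $\widehat g,\epsilon:\widehat{\mathbb{F}_p^r}\to\mathbb{C}$ and the support of $\widehat g$ has at most $t$ elements. For $1\le j\le n$ let $c_j:=F_j(f|_{H_j})$, where $F_j$ is the Fourier transform for $H_j$, regarded as producing a function on $\widehat{\mathbb{F}_p^r}/H_j^\perp$. Consider the following algorithm. 1. Initialize $\widehat f'$, $\widehat f''$ and $Y$ as the zero functions on $\widehat{\mathbb{F}_p^r}$. 2. For each $j=1,\dots,n$: for each of $2t-1$ cosets $\chi_yH_j^\perp\in\widehat{\mathbb{F}_p^r}/H_j^\perp$ for which $|c_j(\chi_yH_j^\perp)|$ is largest, and for every $\chi_z\in\chi_yH_j^\perp$, set $Y(\chi_z):=Y(\chi_z)+1$. 3. For each $\chi_y\in\widehat{\mathbb{F}_p^r}$ with $Y(\chi_y)>2t(m-1)$: let $X$ be the list $(c_1(\chi_yH_1^\perp),\dots,c_n(\chi_yH_n^\perp))$ (with repetitions) and set $\widehat f''(\chi_y):=\mathrm{Median}(\mathrm{Re}(x):x\in X)+i\,\mathrm{Median}(\mathrm{Im}(x):x\in X)$. 4. For each of $t$ elements $\chi_y\in\widehat{\mathbb{F}_p^r}$ for which $|\widehat f''(\chi_y)|$ is largest, set $\widehat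 f'(\chi_y):=\widehat f''(\chi_y)$. 5. Return $\widehat f'$. Then the returned function $\widehat f'$ satisfies $|\mathrm{supp}(\widehat f')|\le t$ and $$\|\widehat f-\widehat f'\|_1\le(1+3\sqrt2)\,\|\epsilon\|_1 .$$
   Context: Notation. $\omega_p=e^{2\pi i/p}$; for $y\in\mathbb{F}_p^r$, $\chi_y:\mathbb{F}_p^r\to\mathbb{C}$ is the character $\chi_y(x)=\omega_p^{x_1y_1+\dots+x_ry_r}$, and $\widehat{\mathbb{F}_p^r}=\{\chi_y:y\in\mathbb{F}_p^r\}$ is the dual group (with $\chi_y\chi_z=\chi_{y+z}$). For $f:\mathbb{F}_p^r\to\mathbb{C}$ the Fourier transform $\widehat f:\widehat{\mathbb{F}_p^r}\to\mathbb{C}$ is $\widehat f(\chi_y)=p^{-r}\sum_{x\in\mathbb{F}_p^r}f(x)\chi_y(x)^{-1}$, so that $f=\sum_{\chi_y}\widehat f(\chi_y)\chi_y$. $\|\cdot\|_1$ is the sum of absolute values over $\widehat{\mathbb{F}_p^r}$. Subspaces $H_1,\dots,H_n$ of $\mathbb{F}_p^r$ are called $m$-generating if $\mathrm{span}_{\mathbb{F}_p}\{H_{i_1},\dots,H_{i_m}\}=\mathbb{F}_p^r$ for all $1\le i_1<\dots<i_m\le n$. For a subspace $H\le\mathbb{F}_p^r$, $H^\perp:=\{\chi_y\in\widehat{\mathbb{F}_p^r}:\chi_y(x)=1\ \forall x\in H\}$. The dual group $\widehat H$ is identified with $\widehat{\mathbb{F}_p^r}/H^\perp$ via $\chi_yH^\perp\leftrightarrow\chi_y|_H$.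 Under this identification the Fourier transform for $H$ of $u:H\to\mathbb{C}$ is the function $\chi_yH^\perp\mapsto |H|^{-1}\sum_{x\in H}u(x)\chi_y(x)^{-1}$. The median of a list of $n$ real numbers ($n$ is odd here) is its middle element after sorting. When the algorithm selects a given number of elements with largest absolute value, ties are broken arbitrarily, and if fewer elements than that number exist, all of them are selected. *)

(* Defs.v *)
From HB Require Import structures.
From mathcomp Require Import all_boot all_order all_algebra.
From mathcomp Require Import reals trigo.
From mathcomp Require Import complex.
From mathcomp Require Import lra.

Set Implicit Arguments.
Unset Strict Implicit.
Unset Printing Implicit Defensive.

Import Order.TTheory GRing.Theory Num.Theory.
Local Open Scope ring_scope.
Local Open Scope complex_scope.

Notation cabs := ComplexField.Normc.normc.

Section Selection.
Variables (R : realType) (T : finType).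

(* S is a possible result of selecting k elements of A of largest weight, ties
   being broken arbitrarily; all of A is selected if it has fewer than k
   elements. *)
Definition is_top (k : nat) (A : {set T}) (w : T -> R) (S : {set T}) : Prop :=
  [/\ S \subset A, #|S| = minn k #|A| &
      forall x y, x \in S -> y \in A :\: S -> w y <= w x].

End Selection.

(* Only meaningful for lists of odd size. *)
Definition median (R : realType) (s : seq R) : R :=
  nth 0 (sort <=%R s) (size s)./2.

Definition cmedian (R : realType) (s : seq R[i]) : R[i] :=
  median [seq complex.Re x | x <- s] +i* median [seq complex.Im x | x <- s].

Section Fourier.
Variables (R : realType) (p r : nat).
Local Notation C := R[i].
Local Notation V := 'rV['F_p]_r.

Definition omega : C := cos (2 * pi / p%:R) +i* sin (2 * pi / p%:R).

(* The exponent is the canonical representative of an element of 'F_p. *)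
Definition chi (y x : V) : C :=
  omega ^+ nat_of_ord (\sum_(i < r) x 0 i * y 0 i : 'F_p).

(* The dual group is parametrized by y |-> chi y, which for p prime is
   injective (chi_inj) and turns sums into products (chiD): functions on and
   subsets of the dual group are functions on and subsets of V. *)
Definition fourier (f : V -> C) (y : V) : C :=
  (p ^ r)%:R^-1 * \sum_(x : V) f x * (chi y x)^-1.

Definition l1norm (u : V -> C) : R := \sum_(y : V) cabs (u y).

Definition supp (u : V -> C) : {set V} := [set y | u y != 0].

Definition m_generating (m n : nat) (H : 'I_n -> {vspace V}) : Prop :=
  forall J : {set 'I_n}, #|J| = m -> (\sum_(j in J) H j)%VS = fullv.

Definition perp (H : {vspace V}) : {set V} :=
  [set y | [forall x : V, (x \in H) ==> (chi y x == 1)]].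

Definition pcoset (H : {vspace V}) (y : V) : {set V} :=
  [set y + z | z in perp H].

Definition pcosets (H : {vspace V}) : {set {set V}} :=
  [set pcoset H y | y : V].

(* Fourier transform of the restriction of u to H, as a function on the cosets
   of perp H. The value does not depend on the representative y of D: see
   coset_fourierE. *)
Definition coset_fourier (H : {vspace V}) (u : V -> C) (D : {set V}) : C :=
  let y := odflt 0 [pick y in D] in
  (#|H|)%:R^-1 * \sum_(x : V | x \in H) u x * (chi y x)^-1.

End Fourier.

Section Algorithm.
Variables (R : realType) (p r t m n : nat).
Local Notation C := R[i].
Local Notation V := 'rV['F_p]_r.
Variables (H : 'I_n -> {vspace V}) (f : V -> C).

Definition alg_c (j : 'I_n) : {set V} -> C := coset_fourier (H j) f.

(* S j is the set of cosets selected in the j-th pass of the voting loop. *)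
Definition alg_Y (S : 'I_n -> {set {set V}}) (z : V) : nat :=
  (\sum_(j < n) \sum_(D in S j) (z \in D))%N.

Definition alg_f2 (S : 'I_n -> {set {set V}}) (y : V) : C :=
  if (2 * t * (m - 1) < alg_Y S y)%N
  then cmedian [seq alg_c j (pcoset R (H j) y) | j <- enum 'I_n]
  else 0.

(* The algorithm is nondeterministic because of ties: f' is one of its possible
   results. *)
Definition alg_returns (f' : V -> C) : Prop :=
  exists S : 'I_n -> {set {set V}}, exists T : {set V},
  [/\ forall j, is_top (2 * t - 1) (pcosets R (H j))
                       (fun D => cabs (alg_c j D)) (S j),
      is_top t [set: V] (fun y => cabs (alg_f2 S y)) T &
      forall y, f' y = if y \in T then alg_f2 S y else 0].

End Algorithm.

Lemma sum_delta_mx (A : nzRingType) (r : nat) (d : 'rV[A]_r) (i : 'I_r) :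
  \sum_(j < r) (delta_mx 0 i : 'rV[A]_r) 0 j * d 0 j = d 0 i.
Proof.
rewrite (bigD1 i) //= big1 => [|j /negbTE ji].
  by rewrite mxE !eqxx mul1r addr0.
by rewrite mxE eqxx ji mul0r.
Qed.

Section CharacterFacts.
Variables (R : realType) (p r : nat).
Hypothesis p_pr : prime p.
Local Notation V := 'rV['F_p]_r.

Lemma omegaX k :
  omega R p ^+ k = cos ((2 * pi / p%:R) *+ k) +i* sin ((2 * pi / p%:R) *+ k).
Proof.
elim: k => [|k IHk]; first by rewrite expr0 !mulr0n cos0 sin0.
rewrite exprS IHk /omega; set a := 2 * pi / p%:R.
by rewrite mulrS cosD sinD; simpc; congr (_ +i* _); rewrite addrC.
Qed.

Lemma omegaXp : omega R p ^+ p = 1.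
Proof.
have p0 : p%:R != 0 :> R by rewrite pnatr_eq0 -lt0n prime_gt0.
by rewrite omegaX -[X in cos X]mulr_natr -[X in sin X]mulr_natr divfK //
  mulrC mulr_natr cos2pi sin2pi.
Qed.

Lemma omega_neq0 : omega R p != 0.
Proof.
apply/eqP => w0; have /eqP := omegaXp.
by rewrite w0 expr0n gtn_eqF ?prime_gt0 // eq_sym oner_eq0.
Qed.

Lemma omegaX_neq1 k : (0 < k < p)%N -> omega R p ^+ k != 1.
Proof.
case/andP=> k0 kp; rewrite omegaX.
have p0 : 0 < p%:R :> R by rewrite ltr0n prime_gt0.
set a := pi / p%:R *+ k : R.
have -> : (2 * pi / p%:R) *+ k = a *+ 2 :> R.
  by rewrite /a mulrnAC mulr2n mulrDl mulrDl mul1r -mulr2n.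
have a_gt0 : 0 < a by rewrite pmulrn_rgt0 // divr_gt0 // pi_gt0.
have a_ltpi : a < pi.
  rewrite /a -mulrnAr -(mulr_natr _^-1) gtr_pMr ?pi_gt0 //.
  by rewrite mulrC ltr_pdivrMr // mul1r ltr_nat.
have s_gt0 : 0 < sin a by rewrite sin_gt0_pi // a_gt0.
apply/eqP => -[+ _]; rewrite cos_mulr2n.
have := cos2Dsin2 a; rewrite mulr2n; nra.
Qed.

Lemma omegaX_modp k : omega R p ^+ (k %% p) = omega R p ^+ k.
Proof.
by rewrite {2}(divn_eq k p) exprD mulnC exprM omegaXp expr1n mul1r.
Qed.

Lemma omegaFpD (a b : 'F_p) :
  omega R p ^+ nat_of_ord (a + b) =
  omega R p ^+ nat_of_ord a * omega R p ^+ nat_of_ord b.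
Proof. by rewrite /= [X in (_ %% X)%N](Fp_cast p_pr) omegaX_modp exprD. Qed.

Lemma chi0 (x : V) : chi R 0 x = 1.
Proof. by rewrite /chi big1 ?expr0 // => i _; rewrite mxE mulr0. Qed.

Lemma chiD (y z x : V) : chi R (y + z) x = chi R y x * chi R z x.
Proof.
rewrite /chi -omegaFpD -big_split /=; congr (_ ^+ nat_of_ord _).
by apply: eq_bigr => i _; rewrite mxE mulrDr.
Qed.

Lemma chi_inj (y z : V) : chi R y =1 chi R z -> y = z.
Proof.
move=> yz; have yz1 x : chi R (y - z) x = 1.
  have zN : chi R z x * chi R (- z) x = 1 by rewrite -chiD subrr chi0.
  by rewrite chiD yz.
apply/subr0_eq/rowP => i; rewrite [RHS]mxE; move: (y - z) yz1 => d yz1.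
have dE : \sum_(j < r) (delta_mx 0 i : V) 0 j * d 0 j = d 0 i.
  exact: sum_delta_mx.
have := yz1 (delta_mx 0 i); rewrite /chi dE => w1; apply/val_inj/eqP => /=.
rewrite -[_ == _]negbK -lt0n; apply/negP => di0.
suff /omegaX_neq1 : (0 < d ord0 i < p)%N by rewrite w1 eqxx.
by rewrite di0 -[X in (_ < X)%N](Fp_cast p_pr) ltn_ord.
Qed.

Lemma coset_fourierE (H : {vspace V}) (u : V -> R[i]) (y : V) :
  coset_fourier H u (pcoset R H y) =
  (#|H|)%:R^-1 * \sum_(x : V | x \in H) u x * (chi R y x)^-1.
Proof.
rewrite /coset_fourier; case: pickP => [w /imsetP[z zH ->]|/(_ y)]; last first.
  rewrite /pcoset -{1}[y]addr0 mem_imset ?inE; last exact: addrI.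
  by move/forallP; case=> x; apply/implyP=> _; rewrite chi0.
congr (_ * _); apply: eq_bigr => x xH.
move: zH; rewrite inE => /forallP/(_ x)/implyP/(_ xH)/eqP z1.
by rewrite /= chiD z1 mulr1.
Qed.

End CharacterFacts.

(* Main.v *)
Require Import Defs.
From mathcomp Require Import all_boot all_order all_algebra.
From mathcomp Require Import reals trigo.
From mathcomp Require Import complex.
From mathcomp Require Import lra zify.

Set Implicit Arguments.
Unset Strict Implicit.
Unset Printing Implicit Defensive.

Import Order.TTheory GRing.Theory Num.Theory.
Local Open Scope ring_scope.
Local Open Scope complex_scope.

(** Write [G] for the support of [ghat], [F] for [fourier f], [f2] for the
    function of medians [alg_f2], [L] for the [l1norm] of [eps] and [E] for
    [L / t]. The value of the [j]-th small transform at the coset of [y] is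
    the sum of [F] over that coset ([coset_fourier_sum]), so it estimates
    [F y], with an error caused by the other points of the coset.

    Two distinct points lie in the same coset of [perp (H j)] for at most
    [m - 1] indices [j], because a character trivial on [m] of the subspaces
    is trivial ([card_perp_le]). Hence, for a fixed [y], at most
    [t * (m - 1)] indices let another point of [G] fall into the coset of
    [y]; at the other indices the error consists of values of [eps] only,
    and each value is charged to at most [m - 1] indices. So among any
    [2 * t * (m - 1) + 1] indices, more than [t * (m - 1)] have pure [eps]
    errors, of total size at most [(m - 1) * L], and one of these errors is
    at most [E] ([good_index]). This one fact is used twice.

    A majority of the [n] estimates of [F y] has at least
    [2 * t * (m - 1) + 1] members, and the median is no further from [F y]
    than each member of a suitable majority ([median_dist]). So the real and
    imaginary parts of the median are both within [E], and the median is
    within [sqrt 2 * E] of [F y] ([voted_error]).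

    If [y] in [G] does not get enough votes, then its coset is missed for at
    least [2 * t * (m - 1) + 1] indices, one of which is good. At that index
    at least [t] of the [2 * t - 1] selected cosets avoid [G]; their values
    come from [eps] alone and dominate the value at [y], which is therefore
    at most [E]. Thus [F y] is at most [2 * E] in modulus ([unvoted_supp]).

    It remains to account for the final selection [T] of at most [t] points.
    A point off [G] that is assigned 0 costs its own value of [eps]. When
    [f2] vanishes off [T], a point of [T] costs at most [sqrt 2 * E] and a
    point of [G] at most [2 * E], up to its value of [eps]; the total is
    [(1 + 2 + sqrt 2) * L], and [2 <= 2 * sqrt 2]. When [f2] does not vanish
    off [T], every point of [T] has a nonzero value of [f2], hence was voted
    for, and costs at most [sqrt 2 * E]; a point of [G] left out of [T]
    costs at most [2 * E] if it was not voted for, and otherwise its [f2] is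
    no larger than that of any point [w] of [T] off [G]; either way
    [2 * sqrt 2 * E + cabs (eps w)] bounds its cost. As [G] minus [T] is no
    larger than [T] minus [G], different [w] can be charged, and the total
    is [(1 + 3 * sqrt 2) * L]. *)

(** * Characters, annihilators and the folding of the spectrum *)

Section CharacterSums.
Variables (R : realType) (p r : nat).
Hypothesis p_pr : prime p.
Local Notation V := 'rV['F_p]_r.
Local Notation chi := (@chi R p r).

Lemma chiC (x y : V) : chi x y = chi y x.
Proof. by rewrite /Defs.chi; under eq_bigr do rewrite mulrC. Qed.

Lemma chiDr (w x y : V) : chi w (x + y) = chi w x * chi w y.
Proof. by rewrite chiC chiD // !(chiC w). Qed.

Lemma chi0r (w : V) : chi w 0 = 1.
Proof. by rewrite chiC chi0. Qed.

Lemma chi_neq0 (w x : V) : chi w x != 0.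
Proof. by rewrite /Defs.chi expf_neq0 ?omega_neq0. Qed.

Lemma chiN (w x : V) : chi (- w) x = (chi w x)^-1.
Proof.
by apply: (mulfI (chi_neq0 w x)); rewrite -chiD // subrr chi0 divff ?chi_neq0.
Qed.

Lemma chiB (w z x : V) : chi (w - z) x = chi w x / chi z x.
Proof. by rewrite chiD // chiN. Qed.

Lemma perpP (K : {vspace V}) (w : V) :
  reflect (forall x, x \in K -> chi w x = 1) (w \in perp R K).
Proof.
rewrite inE; apply: (iffP forallP) => wK x.
  by move=> xK; apply/eqP; exact: (implyP (wK x)).
by apply/implyP=> /wK/eqP.
Qed.

Lemma perp0 (K : {vspace V}) : 0 \in perp R K.
Proof. by apply/perpP => x _; rewrite chi0. Qed.

Lemma perpB (K : {vspace V}) (w z : V) :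
  w \in perp R K -> z \in perp R K -> w - z \in perp R K.
Proof.
move=> /perpP wK /perpP zK; apply/perpP => x xK.
by rewrite chiB wK // zK // divr1.
Qed.

Lemma perp_fullv (w : V) : w \in perp R fullv -> w = 0.
Proof.
move=> /perpP w1; apply: (@chi_inj R p r p_pr) => x.
by rewrite w1 ?memvf // chi0.
Qed.

(** If [chi w] takes a value other than 1 on [K], translating the summation
    variable multiplies the sum by that value. *)
Lemma sum_chi (K : {vspace V}) (w : V) :
  \sum_(x in K) chi w x = if w \in perp R K then #|K|%:R else 0.
Proof.
case: ifPn => [/perpP wK|].
  by rewrite (eq_bigr (fun=> 1)) // sumr_const.
rewrite inE negb_forall => /existsP[a]; rewrite negb_imply => /andP[aK wa1].
have shift : \sum_(x in K) chi w x = chi w a * \sum_(x in K) chi w x.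
  rewrite mulr_sumr (reindex_inj (addrI a)) /=.
  by apply: eq_big => [x|x _]; rewrite ?rpredDl // chiDr.
apply/eqP; have /eqP := shift.
rewrite -subr_eq0 -{1}[X in X - _]mul1r -mulrBl mulf_eq0 subr_eq0 eq_sym.
by rewrite (negbTE wa1).
Qed.

Lemma fourier_inversion (f : V -> R[i]) (x : V) :
  \sum_z fourier f z * chi z x = f x.
Proof.
have p0 : (p ^ r)%:R != 0 :> R[i].
  by rewrite pnatr_eq0 expn_eq0 negb_and -lt0n prime_gt0.
under eq_bigr => z _ do rewrite /fourier -mulrA mulr_suml mulr_sumr.
rewrite exchange_big /= (bigD1 x) //= [X in _ + X]big1 => [|a ax].
  rewrite addr0 (eq_bigr (fun=> (p ^ r)%:R^-1 * f x)) => [|z _].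
    rewrite sumr_const cardT -cardE card_mx mul1n card_Fp //.
    by rewrite -[_ *+ (p ^ r)]mulr_natl mulVKf.
  by rewrite divfK ?chi_neq0.
have xa : x - a \notin perp R fullv.
  by apply: contraNN ax => /perp_fullv/subr0_eq ->.
transitivity ((p ^ r)%:R^-1 * f a *
    \sum_(z in (fullv : {vspace V})) chi (x - a) z).
  rewrite mulr_sumr; apply: eq_big => [z|z _]; first by rewrite memvf.
  by rewrite chiB !(chiC z) mulrAC -!mulrA.
by rewrite sum_chi (negbTE xa) mulr0.
Qed.

Lemma mem_pcoset (K : {vspace V}) (y z : V) :
  (z \in pcoset R K y) = (z - y \in perp R K).
Proof.
apply/imsetP/idP => [[w wK ->]|zK]; first by rewrite addrC addKr.
by exists (z - y); rewrite // addrC subrK.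
Qed.

Lemma pcoset_refl (K : {vspace V}) (y : V) : y \in pcoset R K y.
Proof. by rewrite mem_pcoset subrr perp0. Qed.

Lemma pcoset_eq (K : {vspace V}) (y z : V) :
  z \in pcoset R K y -> pcoset R K z = pcoset R K y.
Proof.
rewrite mem_pcoset => zy; apply/setP => w; rewrite !mem_pcoset.
have -> : w - y = (w - z) - (0 - (z - y)).
  by rewrite sub0r opprK addrA subrK.
apply/idP/idP => wK; first exact: perpB wK (perpB (perp0 _) zy).
have -> : w - z = (w - z) - (0 - (z - y)) - (z - y).
  by rewrite sub0r opprK addrK.
exact: perpB wK zy.
Qed.

Lemma pcosets_pcoset (K : {vspace V}) (D : {set V}) (z : V) :
  D \in pcosets R K -> z \in D -> D = pcoset R K z.
Proof. by case/imsetP => y _ -> /pcoset_eq. Qed.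

(** Restricting to [K] folds the spectrum of [f] modulo [perp K]: expand [f]
    in characters and use their orthogonality on [K]. *)
Lemma coset_fourier_sum (K : {vspace V}) (f : V -> R[i]) (D : {set V}) :
  D \in pcosets R K -> coset_fourier K f D = \sum_(z in D) fourier f z.
Proof.
case/imsetP=> y _ ->; rewrite coset_fourierE //.
have K0 : #|K|%:R != 0 :> R[i].
  by rewrite pnatr_eq0 -lt0n; apply/card_gt0P; exists 0; rewrite mem0v.
under eq_bigr => x _ do rewrite -(fourier_inversion f x) mulr_suml.
rewrite exchange_big /= mulr_sumr [RHS]big_mkcond; apply: eq_bigr => z _.
under eq_bigr => x _ do rewrite -mulrA -chiB.
rewrite -mulr_sumr sum_chi mem_pcoset; case: ifP => _; last by rewrite !mulr0.
by rewrite mulrCA mulVf ?mulr1.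
Qed.

End CharacterSums.

(** * Points falling into a common coset *)

Section Collisions.
Variables (R : realType) (p r m n : nat).
Hypothesis p_pr : prime p.
Local Notation V := 'rV['F_p]_r.
Variable H : 'I_n -> {vspace V}.
Hypotheses (m_gt0 : (0 < m)%N) (genH : m_generating m H).

(** A character trivial on [m] of the subspaces is trivial on their span,
    which is the whole space. *)
Lemma card_perp_le (d : V) :
  d != 0 -> (#|[set j | d \in perp R (H j)]| <= m - 1)%N.
Proof.
apply: contraNT; rewrite -ltnNge; set A := [set j | _] => mA.
set J := [set j in take m (enum A)].
have cardJ : #|J| = m.
  rewrite cardsE (card_uniqP _) ?take_uniq ?enum_uniq // size_takel //.
  by rewrite -cardE; lia.
apply/eqP/(@perp_fullv R p r p_pr)/perpP => x _.
have /memv_sumP[v vH ->] : x \in (\sum_(j in J) H j)%VS.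
  by rewrite genH ?memvf.
elim/big_ind: _ => [|y z dy dz|j jJ]; first exact: chi0r.
  by rewrite chiDr // dy dz mulr1.
have : j \in A by move: jJ; rewrite inE => /mem_take; rewrite mem_enum.
by rewrite inE => /perpP; apply; apply: vH.
Qed.

Lemma card_collisions_le (G : {set V}) (y : V) :
  (#|[set j | [exists z in G :\ y, (z - y)%R \in perp R (H j)]]|
     <= #|G :\ y| * (m - 1))%N.
Proof.
rewrite -sum_nat_const -sum1_card.
apply: (@leq_trans (\sum_j \sum_(z in G :\ y) ((z - y)%R \in perp R (H j)))%N).
  rewrite big_mkcond /=; apply: leq_sum => j _; case: ifP => //.
  rewrite inE => /existsP[z /andP[zG zj]].
  by rewrite (bigD1 z) //= zj.
rewrite exchange_big /=; apply: leq_sum => z; rewrite !inE => /andP[zy _].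
have := @card_perp_le (z - y); rewrite subr_eq0 => /(_ zy).
by rewrite -sum1dep_card big_mkcond.
Qed.

(** Exchanging the sums, the weight of each [z] is counted once for each of
    the at most [m - 1] indices at which [z] collides with [y]. *)
Lemma sum_collisions_le (u : V -> R) (y : V) :
  (forall z, 0 <= u z) ->
  \sum_j \sum_(z | (z != y) && (z - y \in perp R (H j))) u z
    <= (m - 1)%:R * \sum_z u z.
Proof.
move=> u0; under eq_bigr do rewrite big_mkcondr.
rewrite exchange_big /=.
rewrite mulr_sumr [leRHS](bigID (fun z => z != y)) /=.
rewrite ler_wpDr ?sumr_ge0 // => [z _|]; first by rewrite mulr_ge0.
apply: ler_sum => z zy.
rewrite -big_mkcond /= sumr_const -[_ *+ #|_|]mulr_natl ler_wpM2r // ler_nat.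
have := @card_perp_le (z - y); rewrite subr_eq0 => /(_ zy).
by rewrite cardsE.
Qed.

End Collisions.

(** * Complex modulus, medians and domination *)

Section ModulusAndMedian.
Variable R : realType.

Lemma cabs_ge0 (x : R[i]) : 0 <= cabs x.
Proof. by case: x => a b; rewrite sqrtr_ge0. Qed.

Lemma cabsD (x y : R[i]) : cabs (x + y) <= cabs x + cabs y.
Proof. exact: le_normcD. Qed.

Lemma cabsN (x : R[i]) : cabs (- x) = cabs x.
Proof. exact: normcN. Qed.

Lemma cabsB (x y : R[i]) : cabs (x - y) = cabs (y - x).
Proof. by rewrite -cabsN opprB. Qed.

Lemma cabs_sum (I : Type) (s : seq I) (P : pred I) (F : I -> R[i]) :
  cabs (\sum_(i <- s | P i) F i) <= \sum_(i <- s | P i) cabs (F i).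
Proof.
elim/big_ind2: _ => [|x a y b xa yb|//].
  by rewrite ComplexField.Normc.normc0.
exact: le_trans (cabsD _ _) (lerD xa yb).
Qed.

Lemma ReB (x y : R[i]) : complex.Re (x - y) = complex.Re x - complex.Re y.
Proof. by case: x y => [a b] [c d]. Qed.

Lemma ImB (x y : R[i]) : complex.Im (x - y) = complex.Im x - complex.Im y.
Proof. by case: x y => [a b] [c d]. Qed.

Lemma Re_le_cabs (x : R[i]) : `|complex.Re x| <= cabs x.
Proof.
by case: x => a b /=; rewrite -sqrtr_sqr ler_wsqrtr // lerDl sqr_ge0.
Qed.

Lemma Im_le_cabs (x : R[i]) : `|complex.Im x| <= cabs x.
Proof.
by case: x => a b /=; rewrite -sqrtr_sqr ler_wsqrtr // lerDr sqr_ge0.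
Qed.

Lemma cabs_le_sqrt2 (x : R[i]) (e : R) :
  `|complex.Re x| <= e -> `|complex.Im x| <= e -> cabs x <= Num.sqrt 2 * e.
Proof.
case: x => a b /= ae be.
have e0 : 0 <= e by exact: le_trans ae.
rewrite -[X in _ * X](ger0_norm e0) -sqrtr_sqr -sqrtrM // ler_wsqrtr //.
rewrite -(real_normK (num_real a)) -(real_normK (num_real b)).
have := normr_ge0 a; have := normr_ge0 b; nra.
Qed.

Lemma median_count (s : seq R) (k : nat) : size s = k.*2.+1 ->
  (k < count (fun x => (x <= median s)%R) s)%N /\
  (k < count (fun x => (median s <= x)%R) s)%N.
Proof.
move=> sz; rewrite /median sz /= uphalf_double; set s' := sort _ s.
have sz' : size s' = k.*2.+1 by rewrite size_sort.
have mono := le_sorted_leq_nth (0 : R) (sort_le_sorted s).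
rewrite -!(count_sort <=%R _ s) -/s'; split.
  rewrite -(cat_take_drop k.+1 s') count_cat; apply: leq_trans (leq_addr _ _).
  rewrite cat_take_drop (_ : count _ _ = size (take k.+1 s')).
    by rewrite size_takel // sz'; lia.
  apply/eqP; rewrite -all_count; apply/(all_nthP 0) => i.
  rewrite size_takel ?sz' => [ik|]; last by lia.
  by rewrite nth_take //; apply: mono; rewrite ?inE ?sz'; lia.
rewrite -(cat_take_drop k s') count_cat; apply: leq_trans (leq_addl _ _).
rewrite cat_take_drop (_ : count _ _ = size (drop k s')).
  by rewrite size_drop sz'; lia.
apply/eqP; rewrite -all_count; apply/(all_nthP 0) => i.
rewrite size_drop sz' => ik.
by rewrite nth_drop; apply: mono; rewrite ?inE ?sz'; lia.
Qed.

(** The entries on the side of the median facing away from [a], together with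
    the median itself, form a majority and are no closer to [a] than the
    median is. *)
Lemma median_dist (n k : nat) (F : 'I_n -> R) (a : R) : n = k.*2.+1 ->
  (k < #|[set j | (`|median [seq F i | i <- enum 'I_n] - a|
                     <= `|F j - a|)%R]|)%N.
Proof.
move=> nE; set s := map F _.
have sz : size s = k.*2.+1 by rewrite size_map size_enum_ord.
have [lo hi] := median_count sz.
have cE (P : pred R) : count P s = #|[set j | P (F j)]|.
  by rewrite count_map -sum1_count big_enum_cond -sum1dep_card.
move: lo hi; rewrite !cE => lo hi.
have [Ma|aM] := leP (median s) a.
  apply: leq_trans lo _; apply/subset_leq_card/subsetP => j; rewrite !inE => FM.
  by rewrite !ler0_norm ?subr_le0 ?lerN2 ?lerD2r // (le_trans FM).
apply: leq_trans hi _; apply/subset_leq_card/subsetP => j; rewrite !inE => FM.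
by rewrite !ger0_norm ?subr_ge0 ?lerD2r ?(le_trans _ FM) // ltW.
Qed.

(** Every [a x] is at most the average of [b] over [B]. *)
Lemma ler_sum_card (T : finType) (A B : {set T}) (a b : T -> R) :
  (#|A| <= #|B|)%N ->
  (forall x y, x \in A -> y \in B -> a x <= b y) ->
  (forall y, y \in B -> 0 <= b y) ->
  \sum_(x in A) a x <= \sum_(y in B) b y.
Proof.
move=> AB ab b0.
have [B0|B_gt0] := posnP #|B|.
  have A0 : A = set0 by apply/eqP; rewrite -cards_eq0 -leqn0 -B0.
  by rewrite A0 big_set0 sumr_ge0.
have natE (C : {set T}) c : #|C|%:R * c = \sum_(z in C) c.
  by rewrite sumr_const mulr_natl.
rewrite -(@ler_pM2l _ #|B|%:R) ?ltr0n //.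
apply: (@le_trans _ _ (#|A|%:R * \sum_(y in B) b y)); last first.
  by rewrite ler_wpM2r ?sumr_ge0 // ler_nat.
rewrite mulr_sumr natE; apply: ler_sum => x xA.
by rewrite natE; apply: ler_sum => y yB; apply: ab.
Qed.

End ModulusAndMedian.

(** * The error of the estimates *)

Lemma cardsD_ge (T : finType) (A B : {set T}) : (#|A| - #|B| <= #|A :\: B|)%N.
Proof. by rewrite cardsD leq_sub2l ?subset_leq_card ?subsetIr. Qed.

Section Estimates.
Variables (R : realType) (p r t m n : nat).
Hypotheses (p_pr : prime p) (t_gt0 : (0 < t)%N) (m_gt0 : (0 < m)%N).
Hypothesis n_def : n = (4 * t * (m - 1) + 1)%N.
Local Notation V := 'rV['F_p]_r.
Variable H : 'I_n -> {vspace V}.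
Hypothesis genH : m_generating m H.
Variables f ghat eps : V -> R[i].
Hypothesis f_dec : forall y, fourier f y = ghat y + eps y.
Hypothesis ghat_supp : (#|supp ghat| <= t)%N.
Local Notation L := (l1norm eps).
Local Notation c j y := (alg_c H f j (pcoset R (H j) y)).

Lemma fourier_off_supp (y : V) : y \notin supp ghat -> fourier f y = eps y.
Proof. by rewrite inE negbK f_dec => /eqP ->; rewrite add0r. Qed.

Lemma l1norm_ge0 (u : V -> R[i]) : 0 <= l1norm u.
Proof. by apply: sumr_ge0 => y _; apply: cabs_ge0. Qed.

(** When no other point of the support of [ghat] shares the coset of [y],
    the remaining terms of the folded spectrum are values of [eps]. *)
Lemma coset_value_error (j : 'I_n) (y : V) :
  ~~ [exists z in supp ghat :\ y, (z - y)%R \in perp R (H j)] ->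
  cabs (c j y - fourier f y) <=
    \sum_(z | (z != y) && (z - y \in perp R (H j))) cabs (eps z).
Proof.
move=> noG; rewrite /alg_c coset_fourier_sum //; last exact: imset_f.
rewrite (bigD1 y) ?pcoset_refl //= addrAC subrr add0r.
apply: le_trans (cabs_sum _ _ _) _.
rewrite le_eqVlt; apply/orP; left; apply/eqP.
apply: eq_big => z; rewrite mem_pcoset 1?andbC // => /andP[zy zj].
rewrite fourier_off_supp //; apply: contra noG => zG.
by apply/exists_inP; exists z => //; rewrite in_setD1 zy.
Qed.

(** The indices at which [y] collides with the support of [ghat] are too few
    to exhaust half of [J]; were all the other errors larger than [L / t],
    their sum would exceed the total [(m - 1) * L] that the collisions of
    [y] allow. *)
Lemma good_index (J : {set 'I_n}) (y : V) : (2 * t * (m - 1) < #|J|)%N ->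
  exists2 j, j \in J & cabs (c j y - fourier f y) <= L / t%:R.
Proof.
move=> Jbig; set B := [set j | [exists z in supp ghat :\ y,
  (z - y)%R \in perp R (H j)]].
have tR : 0 < t%:R :> R by rewrite ltr0n.
have Bsmall : (#|B| <= t * (m - 1))%N.
  apply: leq_trans (card_collisions_le R p_pr m_gt0 genH (supp ghat) y) _.
  rewrite leq_mul2r; apply/orP; right.
  exact: leq_trans (subset_leq_card (subsetDl _ _)) ghat_supp.
have JB : (t * (m - 1) < #|J :\: B|)%N.
  apply: leq_trans (cardsD_ge J B); rewrite ltn_subRL.
  apply: leq_ltn_trans Jbig; rewrite -mulnA mul2n -addnn.
  by rewrite leq_add2r.
pose e j := \sum_(z | (z != y) && (z - y \in perp R (H j))) cabs (eps z).
have [/exists_inP[j]|] := boolP [exists j in J :\: B, e j <= L / t%:R].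
  rewrite !inE => /andP[jB jJ] ej; exists j => //.
  by apply: le_trans ej; apply: coset_value_error.
rewrite negb_exists_in => /forall_inP far.
have e_ge0 j : 0 <= e j by apply: sumr_ge0 => z _; apply: cabs_ge0.
have sum_e : \sum_(j in J :\: B) e j <= (m - 1)%:R * L.
  apply: le_trans (sum_collisions_le p_pr m_gt0 genH y
    (fun z => cabs_ge0 (eps z))).
  by rewrite [leRHS](bigID (mem (J :\: B))) /= lerDl sumr_ge0 // => j _;
    apply: e_ge0.
suff : (m - 1)%:R * L < \sum_(j in J :\: B) e j by rewrite ltNge sum_e.
apply: (@le_lt_trans _ _ (\sum_(j in J :\: B) L / t%:R)).
  rewrite sumr_const -[leRHS]mulr_natl mulrCA [leLHS]mulrC.
  rewrite ler_wpM2l ?l1norm_ge0 // ler_pdivlMr // -natrM ler_nat mulnC.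
  exact: ltnW.
have /card_gt0P[j jJB] : (0 < #|J :\: B|)%N by apply: leq_ltn_trans JB.
apply: ltr_sum; last by move=> i iJB; rewrite ltNge far.
by apply/hasP; exists j; rewrite // mem_index_enum.
Qed.

(** The good index is sought separately for the real and the imaginary part,
    in the majority supplied by [median_dist]; this is what costs [sqrt 2]. *)
Lemma cmedian_error (y : V) :
  cabs (cmedian [seq c j y | j <- enum 'I_n] - fourier f y)
    <= Num.sqrt 2 * (L / t%:R).
Proof.
have nE : n = (2 * t * (m - 1)).*2.+1 by rewrite n_def; lia.
apply: cabs_le_sqrt2; rewrite (ReB, ImB) /= -map_comp.
  have [j] := good_index y (median_dist (fun j => complex.Re (c j y))
    (complex.Re (fourier f y)) nE).
  rewrite inE -ReB => Mj; apply: le_trans.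
  exact: le_trans Mj (Re_le_cabs _).
have [j] := good_index y (median_dist (fun j => complex.Im (c j y))
  (complex.Im (fourier f y)) nE).
rewrite inE -ImB => Mj; apply: le_trans.
exact: le_trans Mj (Im_le_cabs _).
Qed.

(** Cosets are disjoint: the only one that can contain [z] is [pcoset K z]. *)
Lemma sum_pcosets_le (K : {vspace V}) (B : {set {set V}}) (u : V -> R) :
  B \subset pcosets R K -> (forall z, 0 <= u z) ->
  \sum_(D in B) \sum_(z in D) u z <= \sum_z u z.
Proof.
move=> BK u0; under eq_bigr do rewrite big_mkcond.
rewrite exchange_big /=; apply: ler_sum => z _.
rewrite -big_mkcondr /=.
rewrite -[leRHS](big_pred1_eq +%R (pcoset R K z) (fun=> u z)).
rewrite [leRHS](bigID [pred D | (D \in B) && (z \in D)]) /=.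
rewrite ler_wpDr ?sumr_ge0 //.
rewrite le_eqVlt; apply/orP; left; apply/eqP; apply: eq_bigl => D.
case DB: (D \in B) => /=; last by rewrite andbF.
case zD: (z \in D); last by rewrite andbF.
by rewrite -(pcosets_pcoset p_pr (subsetP BK D DB) zD) eqxx.
Qed.

Section Voting.
Variable S : 'I_n -> {set {set V}}.
Hypothesis S_top : forall j, is_top (2 * t - 1) (pcosets R (H j))
  (fun D => cabs (alg_c H f j D)) (S j).

Lemma card_missed (y : V) : (alg_Y S y <= 2 * t * (m - 1))%N ->
  (2 * t * (m - 1) < #|[set j | pcoset R (H j) y \notin S j]|)%N.
Proof.
set A := [set j | _] => Yle.
have : (#|~: A| <= alg_Y S y)%N.
  rewrite -sum1_card big_mkcond; apply: leq_sum => j _.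
  rewrite !inE negbK; case: ifP => // yS.
  by rewrite (bigD1 (pcoset R (H j) y)) //= pcoset_refl.
have := cardsC A; rewrite card_ord; lia.
Qed.

(** As the coset of [y] is not selected, exactly [2 * t - 1] cosets are, and
    at most [t - 1] of them meet the support of [ghat], since [y] uses up
    one of its at most [t] points. The others number at least [t], have
    values that are sums of [eps] over disjoint sets, and all dominate the
    value at [y]. *)
Lemma missed_coset_value (j : 'I_n) (y : V) : y \in supp ghat ->
  pcoset R (H j) y \notin S j -> cabs (c j y) <= L / t%:R.
Proof.
move=> yG yS; have [S_sub S_card S_max] := S_top j.
have y_coset : pcoset R (H j) y \in pcosets R (H j) by apply: imset_f.
have cardS : #|S j| = (2 * t - 1)%N.
  have : S j \proper pcosets R (H j).
    by apply/properP; split=> //; exists (pcoset R (H j) y).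
  by move/proper_card; rewrite S_card; lia.
set Bad := [set pcoset R (H j) z | z in supp ghat :\ y].
have cardBad : (#|Bad| <= t - 1)%N.
  apply: leq_trans (leq_imset_card _ _) _.
  by rewrite leq_subRL //; move: ghat_supp; rewrite (cardsD1 y) yG.
have cardB : (t <= #|S j :\: Bad|)%N.
  apply: leq_trans (cardsD_ge _ _); rewrite cardS.
  by apply: leq_trans (leq_sub2l _ cardBad); lia.
have tR : 0 < t%:R :> R by rewrite ltr0n.
rewrite ler_pdivlMr //.
apply: (@le_trans _ _ (\sum_(D in S j :\: Bad) cabs (c j y))).
  by rewrite sumr_const -[leRHS]mulr_natr ler_wpM2l ?cabs_ge0 // ler_nat.
have SB : S j :\: Bad \subset pcosets R (H j).
  by apply: subset_trans S_sub; apply: subsetDl.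
apply: le_trans (sum_pcosets_le SB (fun z => cabs_ge0 (eps z))).
apply: ler_sum => D DB; have := DB; rewrite inE => /andP[DnB DS].
have DK := subsetP S_sub D DS.
apply: (@le_trans _ _ (cabs (alg_c H f j D))).
  by apply: S_max => //; rewrite inE yS.
rewrite /alg_c coset_fourier_sum //; apply: le_trans (cabs_sum _ _ _) _.
rewrite le_eqVlt; apply/orP; left; apply/eqP; apply: eq_bigr => z zD.
rewrite fourier_off_supp //; apply/negP => zG.
have DE := pcosets_pcoset p_pr DK zD.
have [zy|zy] := eqVneq z y; first by rewrite -zy -DE DS in yS.
by move/imsetP: DnB; apply; exists z; rewrite // in_setD1 zy.
Qed.

(** Among the indices that miss the coset of [y], a good one bounds the
    distance of [fourier f y] to a coset value that is itself small. *)
Lemma unvoted_supp (y : V) : y \in supp ghat ->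
  (alg_Y S y <= 2 * t * (m - 1))%N -> cabs (fourier f y) <= 2 * (L / t%:R).
Proof.
move=> yG /card_missed/(good_index y)[j]; rewrite inE => yS cj.
rewrite -[fourier f y](subKr (c j y)) mulr_natl mulr2n.
apply: le_trans (cabsD _ _) _; rewrite cabsN.
by apply: lerD => //; apply: missed_coset_value.
Qed.

Lemma voted_error (y : V) : (2 * t * (m - 1) < alg_Y S y)%N ->
  cabs (fourier f y - alg_f2 t m H f S y) <= Num.sqrt 2 * (L / t%:R).
Proof. by rewrite cabsB /alg_f2 => ->; apply: cmedian_error. Qed.

Lemma unvoted_f2 (y : V) : (alg_Y S y <= 2 * t * (m - 1))%N ->
  alg_f2 t m H f S y = 0.
Proof. by rewrite /alg_f2 ltnNge => ->. Qed.

(** * Accounting for the final selection *)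

Variable T : {set V}.
Hypothesis T_top : is_top t [set: V] (fun y => cabs (alg_f2 t m H f S y)) T.
Local Notation E := (L / t%:R).
Local Notation f2 := (alg_f2 t m H f S).

Lemma card_top : (#|T| <= t)%N /\ (#|supp ghat :\: T| <= #|T :\: supp ghat|)%N.
Proof.
have [_ cardT _] := T_top; split; first by rewrite cardT geq_minl.
rewrite -(leq_add2l #|supp ghat :&: T|) cardsID setIC cardsID cardT.
by rewrite leq_min ghat_supp cardsT max_card.
Qed.

Lemma sqrt2_ge1 : 1 <= Num.sqrt 2 :> R.
Proof. by rewrite -[leLHS]sqrtr1 ler_wsqrtr // ler1n. Qed.

Lemma sqrt2_le2 : Num.sqrt 2 <= 2 :> R.
Proof.
have s0 := sqrtr_ge0 (2 : R); have := @sqr_sqrtr R 2 (ler0n _ 2); nra.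
Qed.

Lemma sum_cst_le (A : {set V}) (k : R) : (#|A| <= t)%N -> 0 <= k ->
  \sum_(y in A) k * E <= k * L.
Proof.
move=> At k0; have tR : 0 < t%:R :> R by rewrite ltr0n.
rewrite -mulr_sumr ler_wpM2l // sumr_const -[_ *+ _]mulr_natr mulrAC.
by rewrite ler_pdivrMr // ler_wpM2l ?l1norm_ge0 // ler_nat.
Qed.

(** Here [f2] is the returned function: the final selection loses nothing,
    and every cost is an estimation error or a value of [eps]. *)
Lemma l1_error_f2_zero_off_top : (forall y, y \notin T -> f2 y = 0) ->
  l1norm (fun y => fourier f y - (if y \in T then f2 y else 0))
    <= (1 + 3 * Num.sqrt 2) * L.
Proof.
move=> f2_off; have s1 := sqrt2_ge1; have s2 := sqrt2_le2.
have E0 : 0 <= E by rewrite divr_ge0 ?l1norm_ge0.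
have L0 := l1norm_ge0 eps.
apply: (@le_trans _ _ (\sum_(y in T) Num.sqrt 2 * E
  + \sum_(y in supp ghat) 2 * E + L)).
  rewrite [\sum_(y in T) _]big_mkcond [\sum_(y in supp ghat) _]big_mkcond.
  rewrite {1 4}/l1norm -!big_split /=; apply: ler_sum => y _.
  have ey0 := cabs_ge0 (eps y).
  have -> : (if y \in T then f2 y else 0) = f2 y.
    by case: ifPn => // /f2_off.
  have [Yle|Ygt] := leqP (alg_Y S y) (2 * t * (m - 1)).
    rewrite (unvoted_f2 Yle) subr0.
    have [yG|/fourier_off_supp ->] := boolP (y \in supp ghat).
      have := unvoted_supp yG Yle; case: ifP => _; nra.
    by case: ifP => _; nra.
  have := voted_error Ygt; have [yT|/f2_off f20] := boolP (y \in T).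
    by case: ifP => _; nra.
  have [yG|/fourier_off_supp ->] := boolP (y \in supp ghat); first by nra.
  by rewrite f20 subr0; nra.
have [Tt _] := card_top.
have := sum_cst_le Tt (sqrtr_ge0 2).
have := sum_cst_le ghat_supp (ler0n _ 2); nra.
Qed.

(** A nonzero value of [f2] left out of [T] forces all the values in [T] to
    be nonzero, so every point of [T] costs at most the median error. The
    points of the support of [ghat] outside [T] are charged to the points
    that took their place in [T]. *)
Lemma l1_error_f2_nonzero_off_top (v : V) : v \notin T -> f2 v != 0 ->
  l1norm (fun y => fourier f y - (if y \in T then f2 y else 0))
    <= (1 + 3 * Num.sqrt 2) * L.
Proof.
move=> vT f2v; have [_ _ T_max] := T_top; have [Tt GT] := card_top.
have s1 := sqrt2_ge1.
have E0 : 0 <= E by rewrite divr_ge0 ?l1norm_ge0.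
have T_voted y : y \in T -> (2 * t * (m - 1) < alg_Y S y)%N.
  move=> yT; rewrite ltnNge; apply/negP => /unvoted_f2 f2y.
  have := T_max y v yT; rewrite !inE vT f2y ComplexField.Normc.normc0.
  move=> /(_ isT) v0; case/negP: f2v; apply/eqP/ComplexField.Normc.eq0_normc.
  by apply/eqP; rewrite eq_le v0 cabs_ge0.
have missed y w : y \in supp ghat :\: T -> w \in T :\: supp ghat ->
    cabs (fourier f y) <= 2 * (Num.sqrt 2 * E) + cabs (eps w).
  rewrite !in_setD => /andP[yT yG] /andP[wG wT]; have ew0 := cabs_ge0 (eps w).
  have [Yle|Ygt] := leqP (alg_Y S y) (2 * t * (m - 1)).
    have := unvoted_supp yG Yle; nra.
  have f2w : cabs (f2 w) <= Num.sqrt 2 * E + cabs (eps w).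
    rewrite -(fourier_off_supp wG) -[f2 w](subKr (fourier f w)) [leRHS]addrC.
    apply: le_trans (cabsD _ _) _; rewrite cabsN lerD2l.
    exact: voted_error (T_voted w wT).
  have f2yw : cabs (f2 y) <= cabs (f2 w) by apply: T_max; rewrite ?inE ?yT.
  have := cabsD (fourier f y - f2 y) (f2 y); rewrite subrK.
  have := voted_error Ygt; lra.
rewrite {1}/l1norm (bigID (mem T)) /= [X in _ + X](bigID (mem (supp ghat))) /=.
have sumT : \sum_(y in T) cabs (fourier f y - (if y \in T then f2 y else 0))
    <= Num.sqrt 2 * L.
  apply: le_trans (sum_cst_le Tt (sqrtr_ge0 2)).
  by apply: ler_sum => y yT; rewrite yT; apply: voted_error (T_voted y yT).
have sumGT : \sum_(y | (y \notin T) && (y \in supp ghat))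
      cabs (fourier f y - (if y \in T then f2 y else 0))
    <= 2 * Num.sqrt 2 * L
       + \sum_(w | (w \notin supp ghat) && (w \in T)) cabs (eps w).
  rewrite (eq_big (mem (supp ghat :\: T)) (fun y => cabs (fourier f y)));
    first last.
  - by move=> y /andP[/negbTE -> _]; rewrite subr0.
  - by move=> y; rewrite -in_setD.
  apply: le_trans (ler_sum_card GT missed _) _ => [w _|].
    by rewrite addr_ge0 ?cabs_ge0 // mulr_ge0 // mulr_ge0 ?sqrtr_ge0.
  rewrite big_split /= lerD //; last first.
    rewrite le_eqVlt; apply/orP; left; apply/eqP/eq_bigl => w.
    by rewrite in_setD.
  under eq_bigr do rewrite mulrA.
  apply: sum_cst_le; last by rewrite mulr_ge0 ?sqrtr_ge0.
  by apply: leq_trans (subset_leq_card (subsetDl _ _)) Tt.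
have sum_rest : \sum_(y | (y \notin T) && (y \notin supp ghat))
      cabs (fourier f y - (if y \in T then f2 y else 0))
    = \sum_(y | (y \notin supp ghat) && (y \notin T)) cabs (eps y).
  apply: eq_big => [y|y /andP[/negbTE -> /fourier_off_supp ->]].
    by rewrite andbC.
  by rewrite subr0.
have sum_eps : \sum_(w | (w \notin supp ghat) && (w \in T)) cabs (eps w)
    + \sum_(y | (y \notin supp ghat) && (y \notin T)) cabs (eps y) <= L.
  rewrite -bigID /= /l1norm [leRHS](bigID (mem (supp ghat))) /=.
  by rewrite lerDr sumr_ge0 // => y _; apply: cabs_ge0.
rewrite sum_rest; move: sumT sumGT sum_eps; lra.
Qed.

End Voting.
End Estimates.

Theorem theorem10 (R : realType) (p r t m h n : nat)
    (p_prime : prime p) (r_ge1 : (1 <= r)%N) (t_ge1 : (1 <= t)%N)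
    (m_ge1 : (1 <= m)%N) (h_bounds : (1 <= h <= r)%N)
    (n_def : n = (4 * t * (m - 1) + 1)%N)
    (H : 'I_n -> {vspace 'rV['F_p]_r})
    (dimH : forall j, (\dim (H j) = h)%N)
    (genH : m_generating m H)
    (f : 'rV['F_p]_r -> R[i])
    (ghat eps : 'rV['F_p]_r -> R[i])
    (f_dec : forall y, fourier f y = ghat y + eps y)
    (ghat_supp : (#|supp ghat| <= t)%N)
    (f' : 'rV['F_p]_r -> R[i])
    (f'_returned : alg_returns t m H f f') :
  (#|supp f'| <= t)%N /\
  l1norm (fun y => fourier f y - f' y) <=
    (1 + 3 * Num.sqrt 2) * l1norm eps.
Proof.
case: f'_returned => S [T [S_top T_top f'E]]; split.
  have [_ cardT _] := T_top.
  apply: (@leq_trans #|T|); last by rewrite cardT geq_minl.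
  apply/subset_leq_card/subsetP => y; rewrite inE f'E.
  by case: ifP => // _; rewrite eqxx.
rewrite /l1norm; under eq_bigr do rewrite f'E.
have [/forallP f2_off|/forallPn[v]] :=
    boolP [forall y, (y \notin T) ==> (alg_f2 t m H f S y == 0)].
  apply: (@l1_error_f2_zero_off_top R p r t m n) => // y yT.
  exact/eqP/(implyP (f2_off y)).
rewrite negb_imply => /andP[vT f2v].
exact: (@l1_error_f2_nonzero_off_top R p r t m n) vT f2v.
Qed.
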